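(* There exists a cubic (i.e. $3$-regular) graph $G$ of girth $5$ such that $G$ is not (isomorphic to) a subgraph of any minimal Cayley graph. That is, for every finite group $\Gamma$ and every inclusion-minimal generating set $S$ of $\Gamma$, the graph $G$ is not isomorphic to a (not necessarily induced) subgraph of the Cayley graph $\mathrm{Cay}(\Gamma,S)$.
   Context: All graphs are finite, simple and undirected. For a finite group $\Gamma$ and a subset $S\subseteq\Gamma$, the (undirected, right) Cayley graph $\mathrm{Cay}(\Gamma,S)$ has vertex set $\Gamma$, and $a,b\in\Gamma$ form an edge if $a^{-1}b\in S$ or $b^{-1}a\in S$ (the graph is regarded as undirected even if $S$ is not inverse-closed). The Cayley graph $\mathrm{Cay}(\Gamma,S)$ is called minimal if $S$ is an inclusion-minimal generating set of $\Gamma$, i.e. $S$ generates $\Gamma$ and no proper subset of $S$ generates $\Gamma$. The girth of a graph is the length of a shortest cycle in it. *)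

(* Defs.v *)
From mathcomp Require Import all_boot all_fingroup.

Set Implicit Arguments.
Unset Strict Implicit.
Unset Printing Implicit Defensive.

Local Open Scope group_scope.

Record sgraph := SGraph {
  vertex :> finType;
  adj : rel vertex;
  adj_sym : symmetric adj;
  adj_irrefl : irreflexive adj
}.

Definition neighbours (G : sgraph) (x : G) : {set G} := [set y | adj x y].

Definition regular (k : nat) (G : sgraph) : Prop :=
  forall x : G, #|neighbours x| = k.

(* [ucycle] also accepts the empty sequence and, for a symmetric relation,
   the back-and-forth walk [:: x; y] along an edge, hence the size condition. *)
Definition is_cycle (G : sgraph) (c : seq G) : Prop :=
  2 < size c /\ ucycle (@adj G) c.

Definition has_girth (G : sgraph) (g : nat) : Prop :=
  (exists c : seq G, is_cycle c /\ size c = g) /\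
  (forall c : seq G, is_cycle c -> g <= size c).

(* Subgraphs are not required to be induced. *)
Definition isomorphic_to_subgraph (G H : sgraph) : Prop :=
  exists f : G -> H, injective f /\ forall x y : G, adj x y -> adj (f x) (f y).

Section Cayley.
Variables (gT : finGroupType) (S : {set gT}).

(* [a != b] only matters when 1 \in S, where it discards loops. *)
Definition cayley_adj : rel gT :=
  fun a b => (a != b) && ((a^-1 * b \in S) || (b^-1 * a \in S)).

Lemma cayley_adj_sym : symmetric cayley_adj.
Proof. by move=> a b; rewrite /cayley_adj eq_sym orbC. Qed.

Lemma cayley_adj_irrefl : irreflexive cayley_adj.
Proof. by move=> a; rewrite /cayley_adj eqxx. Qed.

Definition cayley_graph : sgraph := SGraph cayley_adj_sym cayley_adj_irrefl.

Definition minimal_generating_set : Prop :=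
  minset (fun A : {set gT} => <<A>> == [set: gT]) S.

End Cayley.

(* Main.v *)
(* The graph [host] is a cubic graph on 12 vertices with nine pentagons.
   Suppose it embeds into Cay(Gamma, S) with S minimal.  Each edge then carries
   a generator and a direction, subject to three constraints.
   - Injectivity: at each vertex, at most one outgoing and at most one incoming
     edge carries a given generator.
   - Minimality: if an edge carries s, its ends are not joined by a path
     avoiding s, since otherwise s would lie in the subgroup generated by the
     other elements of S.  In particular no cycle uses a generator only once.
   - The word read along a pentagon is trivial in Gamma, so it can be followed
     from every vertex: when all its letters but one are known along a walk from
     x, the last one yields a new relation f(y) s = f(x) between two vertices,
     and the first two constraints apply to such relations as well.
   An exhaustive search over the labellings of the edges, one edge at a time,
   finds a contradiction in every branch. *)

Require Import Defs.
From mathcomp Require Import all_boot all_fingroup.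

Set Implicit Arguments.
Unset Strict Implicit.
Unset Printing Implicit Defensive.

Local Open Scope group_scope.

(** * The search procedure *)

(* [(u, c, v)] records that [f u * s = f v], for [f] the embedding and [s] the
   generator of colour [c]. *)
Definition fact := (nat * nat * nat)%type.

(* A colour; the boolean tells whether its generator is inverted. *)
Definition letter := (nat * bool)%type.

Fixpoint move (F : seq fact) (l : letter) (x : nat) : option nat :=
  if F is (u, c, v) :: F' then
    if c == l.1 then
      if l.2 then if v == x then Some u else move F' l x
      else if u == x then Some v else move F' l x
    else move F' l x
  else None.

Fixpoint walk (F : seq fact) (w : seq letter) (x : nat) : option nat :=
  if w is l :: w' then if move F l x is Some y then walk F w' y else None
  else Some x.

Fixpoint label (F : seq fact) (x y : nat) : option letter :=
  if F is (u, c, v) :: F' then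
    if (u == x) && (v == y) then Some (c, false)
    else if (v == x) && (u == y) then Some (c, true)
    else label F' x y
  else None.

Fixpoint read (F : seq fact) (x : nat) (p : seq nat) : option (seq letter) :=
  if p is y :: p' then
    if label F x y is Some l then
      if read F y p' is Some w then Some (l :: w) else None
    else None
  else Some [::].

(** [None] signals a clash with injectivity: two different edges of one colour would leave, or
    enter, the same vertex. *)
Definition insert (a : fact) (F : seq fact) : option (seq fact) :=
  let: (u, c, v) := a in
  if move F (c, false) u is Some v' then
    if v' == v then Some F else None
  else if move F (c, true) v is Some u' then
    if u' == u then Some F else None
  else Some (a :: F).

Definition fact_of (x : nat) (l : letter) (y : nat) : fact :=
  if l.2 then (y, l.1, x) else (x, l.1, y).

(** If the word [l :: w] is trivial, then so is [w] followed by [l], hence a walk along [w] from [x]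
    to [y] forces [l] to lead from [y] back to [x]. Rotating the relator lets any of its letters be
    the missing one. *)
Definition close_at (w : seq letter) (l : letter) (oF : option (seq fact))
    (x : nat) : option (seq fact) :=
  if oF is Some F then
    if walk F w x is Some y then insert (fact_of y l x) F else Some F
  else None.

Definition close (n : nat) (oF : option (seq fact)) (w : seq letter) :=
  if w is l :: w' then foldl (close_at w' l) oF (iota 0 n) else oF.

(* A single pass over the relators is enough for the search to succeed. *)
Definition saturate (n : nat) (W : seq (seq letter)) (F : seq fact) :=
  foldl (close n) (Some F) W.

Definition rotations (w : seq letter) := [seq rot i w | i <- iota 0 (size w)].

(* A pair [(x, p)] is the closed walk from [x] along [p] back to [x]. *)
Definition relators (F : seq fact) (ps : seq (nat * seq nat)) :
    seq (seq letter) :=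
  flatten [seq if read F p.1 (rcons p.2 p.1) is Some w then rotations w
               else [::] | p <- ps].

Definition merge (a b : nat) (L : seq nat) :=
  [seq if x == b then a else x | x <- L].

(** Union-find by relabelling: equal entries mark vertices joined by facts of colours other than
    [g]. *)
Definition components (n g : nat) (F : seq fact) : seq nat :=
  foldr (fun '(u, c, v) L =>
    if c == g then L else merge (nth 0 L u) (nth 0 L v) L) (iota 0 n) F.

(** Detects a violation of minimality: some edge of colour [g] closes a cycle on which no other edge
    has that colour. *)
Definition lonely (n : nat) (F : seq fact) (g : nat) : bool :=
  let L := components n g F in
  has (fun '(u, c, v) => if c == g then nth 0 L u == nth 0 L v else false) F.

(* A conditional, because [||] evaluates both arguments under [vm_compute]. *)
Fixpoint some_lonely (n : nat) (F : seq fact) (k : nat) : bool :=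
  if k is k'.+1 then if lonely n F k' then true else some_lonely n F k'
  else false.

(* An edge to be coloured, with the pentagons that it completes. *)
Definition step := (nat * nat * seq (nat * seq nat))%type.

(** The value [true] means that this branch is contradictory. The rest of the search is passed as
    [next], so that [refutes] can recurse structurally on the steps. *)
Definition attempt (n : nat) (ps : seq (nat * seq nat)) (W : seq (seq letter))
    (F : seq fact) (a : fact) (k : nat)
    (next : seq (seq letter) -> seq fact -> nat -> bool) : bool :=
  if insert a F is Some F1 then
    if some_lonely n F1 k then true else
    if ps is [::] then next W F1 k else
    let W1 := relators F1 ps ++ W in
    if saturate n W1 F1 is Some F2 then next W1 F2 k else true
  else true.

Fixpoint refutes (n : nat) (steps : seq step) (W : seq (seq letter))
    (F : seq fact) (k : nat) {struct steps} : bool :=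
  if steps is (u, v, ps) :: steps' then
    [&& all (fun c => attempt n ps W F (u, c, v) k (refutes n steps'))
            (iota 0 k),
        all (fun c => attempt n ps W F (v, c, u) k (refutes n steps'))
            (iota 0 k)
      & attempt n ps W F (u, k, v) k.+1 (refutes n steps')]
  else false.

(** * Soundness: facts that hold in the group are never refuted *)

Section Soundness.

Variables (gT : finGroupType) (S : {set gT}).
Hypothesis Smin : minimal_generating_set S.
Variables (f : nat -> gT) (n : nat).
Hypothesis finj : {in gtn n &, injective f}.

Lemma minimal_notin_gen s : s \in S -> s \notin <<S :\ s>>.
Proof.
move=> sS; apply/negP => sH.
have [/eqP genS minS] := minsetP Smin.
have subS : S \subset <<S :\ s>>.
  apply/subsetP => t tS; have [->//|ts] := eqVneq t s.
  by apply: mem_gen; rewrite !inE ts.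
have genD : <<S :\ s>> == [set: gT].
  by rewrite eqEsubset subsetT -genS gen_subG.
have := minS _ genD (subsetDl _ _) => /setP /(_ s).
by rewrite !inE eqxx sS.
Qed.

(* A colour may stand for an element of [S] or for its inverse. *)
Definition representative s := if s \in S then s else s^-1.

Definition palette cs :=
  uniq (map representative cs) && all (mem S) (map representative cs).

Implicit Types (cs : seq gT) (F : seq fact).

Definition others cs g := <<S :\ representative (nth 1 cs g)>>.

Lemma mem_others cs g c :
  palette cs -> g < size cs -> c < size cs -> c != g ->
  nth 1 cs c \in others cs g.
Proof.
move=> /andP[uq /allP inS] ltg ltc ncg.
have memS i : i < size cs -> representative (nth 1 cs i) \in S.
  by move=> lti; apply: inS; rewrite map_f ?mem_nth.
have : representative (nth 1 cs c) \in others cs g.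
  apply: mem_gen; rewrite !inE memS // andbT.
  by rewrite -!(nth_map 1 1 representative) // nth_uniq ?size_map.
by rewrite {1}/representative; case: ifP => // _; rewrite groupV.
Qed.

Lemma notin_others cs g :
  palette cs -> g < size cs -> nth 1 cs g \notin others cs g.
Proof.
move=> /andP[_ /allP inS] ltg.
have := minimal_notin_gen (inS _ (map_f representative (mem_nth 1 ltg))).
by rewrite {1}/representative; case: ifP => // _; rewrite groupV.
Qed.

Definition value cs (l : letter) : gT :=
  if l.2 then (nth 1 cs l.1)^-1 else nth 1 cs l.1.

Definition eval cs (w : seq letter) : gT := \prod_(l <- w) value cs l.

Definition bounded cs (w : seq letter) := all (fun l => l.1 < size cs) w.

Definition true_fact cs (a : fact) :=
  let: (u, c, v) := a in
  [&& u < n, v < n, c < size cs & f u * nth 1 cs c == f v].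

Definition true_word cs (w : seq letter) := bounded cs w && (eval cs w == 1).

Lemma eval_cons cs l w : eval cs (l :: w) = value cs l * eval cs w.
Proof. by rewrite /eval big_cons. Qed.

Lemma move_sound cs F l x y :
  all (true_fact cs) F -> move F l x = Some y ->
  [/\ f x * value cs l = f y, y < n & l.1 < size cs].
Proof.
elim: F => //= -[[u c] v] F IH /andP[/and4P[ltu ltv ltc /eqP fuv] /IH {}IH].
case: eqP => [cl|_ /IH //]; case l2: l.2.
  case: eqP => [<- [<-]|_ /IH //].
  by rewrite /value l2 -cl -fuv mulgK.
case: eqP => [<- [<-]|_ /IH //].
by rewrite /value l2 -cl -fuv.
Qed.

Lemma walk_sound cs F w x y :
  all (true_fact cs) F -> x < n -> walk F w x = Some y ->
  [/\ f x * eval cs w = f y & y < n].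
Proof.
move=> tF; elim: w x => [|l w IH] x ltx /=.
  by case=> <-; rewrite /eval big_nil mulg1.
case E: move => [z|//]; have [fz ltz _] := move_sound tF E.
by case/(IH z ltz) => <- lty; rewrite eval_cons mulgA fz.
Qed.

Lemma label_sound cs F l x y :
  all (true_fact cs) F -> label F x y = Some l ->
  f x * value cs l = f y /\ l.1 < size cs.
Proof.
elim: F => //= -[[u c] v] F IH /andP[/and4P[ltu ltv ltc /eqP fuv] /IH {}IH].
case: ifP => [/andP[/eqP <- /eqP <-] [<-] //|_].
case: ifP => [/andP[/eqP <- /eqP <-] [<-]|_ /IH //].
by rewrite /value -fuv mulgK.
Qed.

Lemma read_sound cs F x p w :
  all (true_fact cs) F -> read F x p = Some w ->
  f x * eval cs w = f (last x p) /\ bounded cs w.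
Proof.
move=> tF; elim: p x w => [|y p IH] x w /=.
  by case=> <-; rewrite /eval big_nil mulg1.
case E: label => [l|//]; have [fy ltl] := label_sound tF E.
case E': read => [w'|//] [<-]; have [<- bw] := IH _ _ E'.
by rewrite eval_cons mulgA fy /= ltl.
Qed.

Lemma insert_sound cs F a :
  all (true_fact cs) F -> true_fact cs a ->
  exists2 F', insert a F = Some F' & all (true_fact cs) F'.
Proof.
case: a => [[u c] v] tF ta; have /and4P[ltu ltv ltc /eqP fuv] := ta.
rewrite /insert; case E: move => [v'|].
  have [fv' ltv' _] := move_sound tF E.
  exists F => //; case: eqP => // -[]; apply: finj => //.
  by rewrite -fv' -fuv.
case E': move => [u'|].
  have [fu' ltu' _] := move_sound tF E'.
  exists F => //; case: eqP => // -[]; apply: finj => //.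
  by rewrite -fu' -fuv /value /= mulgK.
by exists ((u, c, v) :: F) => //=; apply/andP.
Qed.

(** [Q] is required by index because [T] has no decidable equality, hence no membership
    predicate. *)
Lemma foldl_option_sound (T : Type) (P : seq fact -> Prop)
    (op : option (seq fact) -> T -> option (seq fact)) (Q : T -> Prop) s :
  (forall F x, P F -> Q x -> exists2 F', op (Some F) x = Some F' & P F') ->
  (forall i x0, i < size s -> Q (nth x0 s i)) ->
  forall F, P F -> exists2 F', foldl op (Some F) s = Some F' & P F'.
Proof.
move=> opP; elim: s => [|x s IH] Qs F PF /=; first by exists F.
have [F' -> PF'] := opP F x PF (Qs 0 x isT).
by apply: IH PF' => i x0 lti; apply: (Qs i.+1).
Qed.

Lemma close_sound cs F w :
  all (true_fact cs) F -> true_word cs w ->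
  exists2 F', close n (Some F) w = Some F' & all (true_fact cs) F'.
Proof.
case: w => [|l w] tF; first by exists F.
case/andP=> /= /andP[ltl _]; rewrite eval_cons => /eqP vw.
rewrite /close; apply: (foldl_option_sound (Q := fun x => x < n)) tF;
  last by move=> i x0; rewrite size_iota => lti; rewrite nth_iota.
move=> {}F x tF ltx; rewrite /close_at; case E: walk => [y|]; last by exists F.
have [fy lty] := walk_sound tF ltx E.
apply: insert_sound => //; rewrite /fact_of.
move: vw => /(canRL (mulKg _)); rewrite mulg1 => ew.
rewrite ew /value in fy; case: (l.2) fy => fy /=; rewrite ltx lty ltl -fy.
  by rewrite invgK eqxx.
by rewrite mulgKV eqxx.
Qed.

Lemma saturate_sound cs F W :
  all (true_fact cs) F -> all (true_word cs) W ->
  exists2 F', saturate n W F = Some F' & all (true_fact cs) F'.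
Proof.
move=> tF tW.
apply: (foldl_option_sound (Q := fun w => true_word cs w)) tF.
  by move=> F' w; apply: close_sound.
by move=> i x0 lti; apply: (all_nthP x0 tW).
Qed.

Lemma true_word_rot cs i w : true_word cs w -> true_word cs (rot i w).
Proof.
case/andP=> bw /eqP ew; apply/andP; split.
  by rewrite /bounded (eq_all_r (mem_rot i w)).
move: ew; rewrite -{1}(cat_take_drop i w) /eval /rot !big_cat /=.
by move=> /(canRL (mulKg _)) ->; rewrite mulg1 mulVg.
Qed.

Lemma relators_sound cs F ps :
  all (true_fact cs) F -> all (true_word cs) (relators F ps).
Proof.
move=> tF; elim: ps => //= -[x p] ps IH; rewrite /relators /= all_cat IH andbT.
case E: read => [w|//]; have [ew bw] := read_sound tF E.
have tw : true_word cs w.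
  by rewrite /true_word bw -(mulKg (f x) (eval cs w)) ew last_rcons mulVg /=.
by apply/allP => _ /mapP[i _ ->]; apply: true_word_rot.
Qed.

(** Each merge joins two classes in the same left coset of [others cs g], since the colour of the
    merging edge lies in that subgroup. *)
Lemma components_sound cs F g :
  palette cs -> g < size cs -> all (true_fact cs) F ->
  size (components n g F) = n /\
  forall x y, x < n -> y < n ->
    nth 0 (components n g F) x = nth 0 (components n g F) y ->
    (f x)^-1 * f y \in others cs g.
Proof.
move=> pcs ltg; elim: F => [_|[[u c] v] F IH] /=.
  rewrite size_iota; split=> // x y ltx lty; rewrite !nth_iota // !add0n => ->.
  by rewrite mulVg group1.
case/andP=> /and4P[ltu ltv ltc /eqP fuv] /IH[].
set L := components n g F => sL HL; case: eqP => [//|/eqP ncg].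
split; first by rewrite size_map.
have uv : (f u)^-1 * f v \in others cs g.
  by rewrite -fuv mulKg; apply: mem_others.
have trans x y z : (f x)^-1 * f y \in others cs g ->
    (f y)^-1 * f z \in others cs g -> (f x)^-1 * f z \in others cs g.
  by move=> xy yz; have := groupM xy yz; rewrite -mulgA mulKVg.
have sym x y : (f x)^-1 * f y \in others cs g ->
    (f y)^-1 * f x \in others cs g.
  by move=> xy; rewrite -groupV invMg invgK.
have toward x : x < n -> nth 0 L x = nth 0 L v ->
    (f u)^-1 * f x \in others cs g.
  by move=> ltx /esym /(HL _ _ ltv ltx); apply: trans.
move=> x y ltx lty; rewrite !(nth_map 0) ?sL //.
case: eqP => [xv|_]; case: eqP => [yv|_].
- by move=> _; apply: trans (toward y lty yv); apply/sym/toward.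
- by move=> uy; apply: trans (HL _ _ ltu lty uy); apply/sym/toward.
- by move=> xu; apply: trans (HL _ _ ltx ltu xu) (toward y lty yv).
- exact: HL.
Qed.

Lemma lonely_sound cs F g :
  palette cs -> g < size cs -> all (true_fact cs) F -> lonely n F g = false.
Proof.
move=> pcs ltg tF; apply/negbTE/hasPn => -[[u c] v] inF; apply/negP.
case: eqP => // cg /eqP; have [_ HL] := components_sound pcs ltg tF.
have := allP tF _ inF => /and4P[ltu ltv _ /eqP fuv] /(HL _ _ ltu ltv).
by rewrite -fuv mulKg cg; apply/negP/notin_others.
Qed.

Lemma some_lonely_sound cs F :
  palette cs -> all (true_fact cs) F -> some_lonely n F (size cs) = false.
Proof.
move=> pcs tF; have : size cs <= size cs by [].
elim: {1 3}(size cs) => //= k IH ltk.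
by rewrite (lonely_sound pcs ltk tF) IH // ltnW.
Qed.

Lemma true_fact_rcons cs s a : true_fact cs a -> true_fact (rcons cs s) a.
Proof.
case: a => [[u c] v] /and4P[ltu ltv ltc fuv].
by rewrite /true_fact ltu ltv size_rcons (ltn_trans ltc) // nth_rcons ltc.
Qed.

Lemma true_word_rcons cs s w : true_word cs w -> true_word (rcons cs s) w.
Proof.
case/andP=> bw /eqP ew; apply/andP; split.
  by apply: sub_all bw => l ltl; rewrite size_rcons (ltn_trans ltl).
rewrite -ew /eval; apply/eqP/eq_big_seq => l /(allP bw) ltl.
by rewrite /value nth_rcons ltl.
Qed.

Definition joined (e : nat * nat) :=
  [&& e.1 < n, e.2 < n &
    (((f e.1)^-1 * f e.2) \in S) || (((f e.2)^-1 * f e.1) \in S)].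

(* A colour not yet in the palette is added as the oriented generator
   [(f u)^-1 * f v], so new colours need be tried in one direction only. *)
Lemma refutes_sound steps W cs F :
  palette cs -> all (true_word cs) W -> all (true_fact cs) F ->
  all (fun st : step => joined st.1) steps ->
  refutes n steps W F (size cs) = false.
Proof.
elim: steps W cs F => //= -[[u v] ps] steps IH W cs F pcs tW tF.
case/andP=> /and3P[/= ltu ltv fS] jst.
(* Stated for any palette [cs'], to serve both the current palette and its extension by a new
   colour. *)
have tryP cs' a : palette cs' -> all (true_word cs') W ->
    all (true_fact cs') F -> true_fact cs' a ->
    attempt n ps W F a (size cs') (refutes n steps) = false.
  move=> pcs' tW' tF' ta; rewrite /attempt.
  have [F1 -> tF1] := insert_sound tF' ta.
  rewrite some_lonely_sound //; case: ps => [|p ps]; first exact: IH.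
  have tW1 : all (true_word cs') (relators F1 (p :: ps) ++ W).
    by rewrite all_cat relators_sound.
  by have [F2 -> tF2] := saturate_sound tF1 tW1; apply: IH.
set s := (f u)^-1 * f v in fS.
have fus : f u * s = f v by rewrite mulKVg.
have fvs : f v * s^-1 = f u by rewrite -fus mulgK.
have sS : representative s \in S.
  by rewrite /representative; case: ifP fS => //= _; rewrite invMg invgK.
have [/mapP[t tcs nst]|new] :=
  boolP (representative s \in map representative cs).
  have [c ltc ct] := nthP 1 tcs.
  have inc : c \in iota 0 (size cs) by rewrite mem_iota.
  apply/negP => /and3P[/allP/(_ _ inc) tuv /allP/(_ _ inc) tvu _].
  (* A known generator labels the edge in one of its two directions. *)
  have [ts|ts] : t = s \/ t = s^-1.
    move: nst; rewrite /representative.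
    by case: ifP => _; case: ifP => _;
      [move->|move->|move<-|move/invg_inj->]; rewrite ?invgK; auto.
  - by rewrite tryP // /true_fact ltu ltv ltc ct ts fus eqxx in tuv.
  - by rewrite tryP // /true_fact ltu ltv ltc ct ts fvs eqxx in tvu.
apply/negP => /and3P[_ _]; rewrite -(size_rcons cs s) tryP //.
- rewrite /palette map_rcons rcons_uniq all_rcons new /= sS.
  exact: pcs.
- by apply: sub_all tW => w; apply: true_word_rcons.
- by apply: sub_all tF => a; apply: true_fact_rcons.
- by rewrite /true_fact ltu ltv size_rcons ltnSn nth_rcons ltnn eqxx fus eqxx.
Qed.

End Soundness.

(* This edge order completes pentagons early, which keeps the search small. *)
Definition plan : seq step :=
 ([:: (0, 1, [::]); (0, 4, [::]); (1, 2, [::]); (3, 4, [::]);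
      (2, 3, [:: (0, [:: 1; 2; 3; 4])]); (2, 5, [::]); (0, 6, [::]);
      (5, 6, [:: (0, [:: 1; 2; 5; 6])]); (4, 7, [::]); (1, 8, [::]);
      (7, 8, [:: (0, [:: 1; 8; 7; 4])]); (7, 9, [::]);
      (6, 9, [:: (0, [:: 4; 7; 9; 6])]); (5, 10, [::]);
      (8, 10, [:: (1, [:: 2; 5; 10; 8])]); (9, 11, [::]);
      (3, 11, [:: (4, [:: 3; 11; 9; 7])]);
      (10, 11, [:: (6, [:: 5; 10; 11; 9]); (2, [:: 3; 11; 10; 5]);
                   (8, [:: 7; 9; 11; 10])])])%N.

Lemma plan_refuted : refutes 12 plan [::] [::] 0.
(* The search runs only once, when the kernel checks the cast at [Qed]. *)
Proof. by vm_cast_no_check (erefl true). Qed.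

(** * The host graph: degree and girth *)

Definition edges : seq (nat * nat) := map fst plan.

Definition edge_rel : rel nat :=
  fun x y => ((x, y) \in edges) || ((y, x) \in edges).

Definition host_adj : rel 'I_12 := relpre val edge_rel.

Lemma host_adj_sym : symmetric host_adj.
Proof. by move=> x y; rewrite /host_adj /edge_rel /= orbC. Qed.

Lemma host_adj_irrefl : irreflexive host_adj.
Proof.
have /allP H : all (fun x => ~~ edge_rel x x) (iota 0 12) by [].
by move=> x; apply/negbTE/H; rewrite mem_iota /=.
Qed.

Definition host : sgraph := SGraph host_adj_sym host_adj_irrefl.

Lemma mem_host (x : host) : val x \in iota 0 12.
Proof. by rewrite mem_iota ltn_ord. Qed.

Lemma host_cubic : regular 3 host.
Proof.
have /allP H : all (fun x => count (edge_rel x) (iota 0 12) == 3) (iota 0 12).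
  by vm_compute.
move=> x; rewrite -[RHS](eqP (H _ (mem_host x))).
rewrite cardsE cardE size_filter -val_enum_ord count_map -enumT.
exact: eq_count.
Qed.

Definition nbrs (x : nat) : seq nat := [seq y <- iota 0 12 | edge_rel x y].

Lemma mem_nbrs (x y : host) : adj x y -> val y \in nbrs (val x).
Proof. by move=> xy; rewrite mem_filter mem_host andbT. Qed.

Lemma host_no_triangle (x y z : host) : adj x y -> adj y z -> ~~ adj z x.
Proof.
have /allP H : all (fun x => all (fun y => all (fun z => ~~ edge_rel z x)
  (nbrs y)) (nbrs x)) (iota 0 12) by vm_compute.
move=> /mem_nbrs xy /mem_nbrs yz.
by have /allP/(_ _ xy)/allP/(_ _ yz) := H _ (mem_host x).
Qed.

Lemma host_no_square (x y z t : host) :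
  adj x y -> adj y z -> adj z t -> adj t x -> (x == z) || (y == t).
Proof.
have /allP H : all (fun x => all (fun y => all (fun z => all (fun t =>
    edge_rel t x ==> (x == z) || (y == t))
  (nbrs z)) (nbrs y)) (nbrs x)) (iota 0 12) by vm_compute.
move=> /mem_nbrs xy /mem_nbrs yz /mem_nbrs zt tx.
have /allP/(_ _ xy)/allP/(_ _ yz)/allP/(_ _ zt)/implyP := H _ (mem_host x).
exact.
Qed.

Lemma host_girth : has_girth host 5.
Proof.
split.
  exists [:: @Ordinal 12 0 isT; @Ordinal 12 1 isT; @Ordinal 12 2 isT;
             @Ordinal 12 3 isT; @Ordinal 12 4 isT].
  by [].
(* Only the lengths 3 and 4 remain to be excluded. *)
case=> [|x [|y [|z [|t [|? ?]]]]] [] // _ /andP[].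
  case/and4P=> xy yz zx _ _.
  by have := host_no_triangle xy yz; rewrite zx.
case/and5P=> xy yz zt tx _ /and3P[].
rewrite !inE !negb_or => /and3P[_ xz _] /andP[_ yt] _.
by have := host_no_square xy yz zt tx; rewrite (negbTE xz) (negbTE yt).
Qed.

Theorem mainTheorem1 :
  exists G : sgraph,
    [/\ regular 3 G,
        has_girth G 5
      & forall (gT : finGroupType) (S : {set gT}),
          minimal_generating_set S ->
          ~ isomorphic_to_subgraph G (cayley_graph S)].
Proof.
exists host; split; [exact: host_cubic | exact: host_girth |].
move=> gT S Smin [f [finj fadj]].
(* The search names vertices by naturals, so the embedding is extended through [inord]; injectivity
   survives below 12. *)
have ginj : {in gtn 12 &, injective (fun x => f (inord x))}.
  by move=> x y ltx lty /finj /(congr1 (@nat_of_ord 12)); rewrite !inordK.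
(* The search starts from the empty palette. *)
have := plan_refuted; rewrite -[0]/(size ([::] : seq gT)).
rewrite (refutes_sound Smin ginj) //; apply/allP => st stp.
have /allP/(_ _ stp)/andP[lt1 lt2] :
  all (fun st : step => (st.1.1 < 12) && (st.1.2 < 12)) plan by [].
rewrite /joined lt1 lt2 /=.
have : @adj host (inord st.1.1) (inord st.1.2).
  change (edge_rel (inord st.1.1 : 'I_12) (inord st.1.2 : 'I_12)).
  by rewrite !inordK // /edge_rel -surjective_pairing map_f.
by move/fadj => /andP[].
Qed.
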